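(* Let $G$ be a finitely generated two step nilpotent group and let $\rho$ be an irreducible complex representation of $G$. Let $\chi$ be the character of $[G,G]$ obtained by restricting $\rho$ to $[G,G]$. Then $\rho$ is finite dimensional if and only if $\chi$ has finite order. Further, in this case the following hold. (1) The order of $\chi$ divides $\dim(\rho)$. (2) $\dim(\rho)=\sqrt{|G_\rho/Z(G_\rho)|}$, where $G_\rho=G/\mathrm{Ker}(\rho)$.
   Context: A representation of $G$ is a homomorphism $\rho: G\to\mathrm{Aut}(V)$ with $V$ a complex vector space, possibly infinite dimensional. Since $G$ is two step nilpotent, $[G,G]$ is central in $G$; the central subgroup $[G,G]$ acts on an irreducible $V$ by scalars, so there is a homomorphism $\chi:[G,G]\to\mathbb{C}^\times$ with $\rho(x)=\chi(x)\,\mathrm{Id}_V$ for all $x \in [G,G]$; this is the character obtained by restricting $\rho$ to $[G,G]$. The order of $\chi$ is the least positive integer $m$ (if any) with $\chi^m=1$. $Z(\cdot)$ denotes the center of a group. *)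

(* Defs.v *)
From HB Require Import structures.
From mathcomp Require Import all_boot all_order all_algebra.
From mathcomp Require Import generic_quotient.
From mathcomp Require Import all_classical all_reals.
From mathcomp Require Export complex.

Set Implicit Arguments.
Unset Strict Implicit.
Unset Printing Implicit Defensive.

Import GRing.Theory Num.Theory.

Local Open Scope quotient_scope.
Local Open Scope classical_set_scope.
Local Open Scope group_scope.

Section Groups.
Variable G : groupType.
Implicit Types (A B S : set G).

Definition subgroup S : Prop := group_closed (mem S).

Definition generated A : set G := smallest subgroup A.

Definition commutator_subgroup A B : set G :=
  generated [set [~ a, b] | a in A & b in B].

Definition center : set G := [set z | forall x, commute z x].

End Groups.

Arguments center G : clear implicits.

Definition derived_subgroup (G : groupType) : set G :=
  commutator_subgroup [set: G] [set: G].
Arguments derived_subgroup G : clear implicits.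

Definition finitely_generated (G : groupType) : Prop :=
  exists2 A : set G, finite_set A & generated A = [set: G].

(* Nilpotency class at most 2: abelian groups are included. *)
Definition two_step_nilpotent (G : groupType) : Prop :=
  commutator_subgroup (derived_subgroup G) [set: G] = [set 1].

Record normalSubgroup (G : groupType) := NormalSubgroup {
  nsub_set :> set G;
  nsub_subgroup : subgroup nsub_set;
  nsub_conj : forall x y : G, nsub_set x -> nsub_set (x ^ y)
}.

Section Quotient.
Variables (G : groupType) (N : normalSubgroup G).

Local Notation inN := (nsub_set N).

Let N1 : inN 1.
Proof. by have [/set_mem] := nsub_subgroup N. Qed.

Let ND x y : inN x -> inN y -> inN (x / y).
Proof.
move=> Nx Ny; have [_ h] := nsub_subgroup N.
by apply/set_mem/(h x y); apply/mem_set.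
Qed.

Let NV x : inN x -> inN x^-1.
Proof. by move=> /(ND N1); rewrite mul1g. Qed.

Let NM x y : inN x -> inN y -> inN (x * y).
Proof. by move=> Nx /NV Ny; rewrite -(invgK y); apply: ND. Qed.

Definition coset_eq (x y : G) : bool := `[< inN (x^-1 * y) >].

Let coset_eq_refl : reflexive coset_eq.
Proof. by move=> x; apply/asboolP; rewrite mulVg. Qed.

Let coset_eq_sym : symmetric coset_eq.
Proof.
move=> x y; apply/asboolP/asboolP => /NV;
by rewrite invgM invgK.
Qed.

Let coset_eq_trans : transitive coset_eq.
Proof.
move=> y x z /asboolP xy /asboolP yz; apply/asboolP.
by have := NM xy yz; rewrite mulgA mulgK.
Qed.

Canonical coset_equiv := EquivRel coset_eq
  coset_eq_refl coset_eq_sym coset_eq_trans.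

Definition quotient_group := {eq_quot coset_equiv}.

HB.instance Definition _ := Choice.on quotient_group.

Local Notation Q := quotient_group.
Local Notation proj := (\pi_{eq_quot coset_equiv} : G -> Q).

Definition quot_one : Q := proj 1.
Definition quot_inv (a : Q) : Q := proj (repr a)^-1.
Definition quot_mul (a b : Q) : Q := proj (repr a * repr b).

Let projP x y : (proj x = proj y) <-> inN (x^-1 * y).
Proof.
split=> [xy|h]; last by apply/(eqmodP coset_equiv)/asboolP.
by have /(eqmodP coset_equiv)/asboolP := xy.
Qed.

Let repr_proj x : inN ((repr (proj x))^-1 * x).
Proof. by apply/projP; rewrite reprK. Qed.

Let proj_ind (P : Q -> Prop) : (forall x, P (proj x)) -> forall a, P a.
Proof. by move=> h a; rewrite -[a]reprK; apply: h. Qed.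

Lemma quot_mulE x y : quot_mul (proj x) (proj y) = proj (x * y).
Proof.
apply/projP; rewrite invgM.
set x' := repr (proj x); set y' := repr (proj y).
have -> : y'^-1 * x'^-1 * (x * y) = (y'^-1 * y) * (x'^-1 * x) ^ y.
  by rewrite /conjg !mulgA mulgK.
by apply: NM; [apply: repr_proj | apply/nsub_conj/repr_proj].
Qed.

Lemma quot_invE x : quot_inv (proj x) = proj x^-1.
Proof.
apply/projP; rewrite invgK; set x' := repr _.
have -> : x' / x = ((x'^-1 * x)^-1) ^ x^-1.
  by rewrite /conjg invgM !invgK !mulgA mulgV mul1g.
by apply/nsub_conj/NV/repr_proj.
Qed.

Let quot_mulA : associative quot_mul.
Proof.
elim/proj_ind => x; elim/proj_ind => y; elim/proj_ind => z.
by rewrite !quot_mulE mulgA.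
Qed.

Let quot_mul1 : left_id quot_one quot_mul.
Proof. by elim/proj_ind => x; rewrite quot_mulE mul1g. Qed.

Let quot_1mul : right_id quot_one quot_mul.
Proof. by elim/proj_ind => x; rewrite quot_mulE mulg1. Qed.

Let quot_mulV : left_inverse quot_one quot_inv quot_mul.
Proof. by elim/proj_ind => x; rewrite quot_invE quot_mulE mulVg. Qed.

Let quot_Vmul : right_inverse quot_one quot_inv quot_mul.
Proof. by elim/proj_ind => x; rewrite quot_invE quot_mulE mulgV. Qed.

HB.instance Definition _ := isGroup.Build quotient_group
  quot_mulA quot_mul1 quot_1mul quot_mulV quot_Vmul.

End Quotient.

Section Center.
Variable G : groupType.

Let center_subgroup : subgroup (center G).
Proof.
split=> [|x y /set_mem Zx /set_mem Zy]; apply/mem_set => z.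
  by rewrite /commute mul1g mulg1.
have Vyz : y^-1 * z = z * y^-1.
  by apply: (mulgI y); rewrite mulgA mulgV mul1g mulgA Zy mulgK.
by rewrite /commute -mulgA Vyz !mulgA Zx.
Qed.

Let center_conj (x y : G) : center G x -> center G (x ^ y).
Proof. by move=> Zx; rewrite /conjg Zx mulgA mulVg mul1g. Qed.

Definition center_nsub := NormalSubgroup center_subgroup center_conj.

End Center.

Local Open Scope ring_scope.

Section Representations.
Variables (C : fieldType) (G : groupType) (V : lmodType C).

Record representation := Representation {
  repr_fun :> G -> {linear V -> V};
  repr_bij : forall g, bijective (repr_fun g);
  reprM : forall (g h : G) (v : V),
    repr_fun (g * h)%g v = repr_fun g (repr_fun h v)
}.

Definition linear_subspace (W : set V) : Prop := submod_closed (mem W).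

Definition irreducible (rho : representation) : Prop :=
  [set: V] <> [set 0] /\
  forall W : set V, linear_subspace W ->
    (forall g v, W v -> W (rho g v)) -> W = [set 0] \/ W = [set: V].

Definition kernel (rho : representation) : set G :=
  [set g | forall v, rho g v = v].

Section Kernel.
Variable rho : representation.

Let rho1 v : rho 1%g v = v.
Proof. by apply: (bij_inj (repr_bij rho 1%g)); rewrite -reprM mulg1. Qed.

Let kernel_subgroup : subgroup (kernel rho).
Proof.
split=> [|x y /set_mem kx /set_mem ky]; apply/mem_set => v; first exact: rho1.
by rewrite -[in LHS](ky v) -reprM mulgVK kx.
Qed.

Let kernel_conj (x y : G) : kernel rho x -> kernel rho (x ^ y)%g.
Proof. by move=> kx v; rewrite /conjg !reprM kx -reprM mulVg rho1. Qed.

Definition kernel_nsub := NormalSubgroup kernel_subgroup kernel_conj.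

Definition repr_image_group : groupType := quotient_group kernel_nsub.

End Kernel.

(* A character of a subgroup [S] is a function on [G] of which only the values
   on [S] are meaningful. *)
Definition is_character (S : set G) (chi : G -> C) : Prop :=
  (forall x, S x -> chi x != 0) /\
  (forall x y, S x -> S y -> chi (x * y)%g = chi x * chi y).

Definition restricts_to (rho : representation) (S : set G) (chi : G -> C) :=
  is_character S chi /\ forall x, S x -> forall v, rho x v = chi x *: v.

Definition character_pow_trivial (S : set G) (chi : G -> C) (m : nat) : Prop :=
  forall x, S x -> chi x ^+ m = 1.

Definition character_order (S : set G) (chi : G -> C) (m : nat) : Prop :=
  [/\ (0 < m)%N, character_pow_trivial S chi m &
    forall k, (0 < k)%N -> character_pow_trivial S chi k -> (m <= k)%N].

Definition character_finite_order (S : set G) (chi : G -> C) : Prop :=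
  exists m, character_order S chi m.

Definition has_dim (n : nat) : Prop := inhabited (Vector.axiom n V).

Definition finite_dimensional : Prop := exists n, has_dim n.

End Representations.

Arguments has_dim {C} V n.
Arguments finite_dimensional {C} V.

(* Main.v *)
From HB Require Import structures.
Require Import Defs.
From mathcomp Require Import all_boot all_order all_algebra.
From mathcomp Require Import all_classical all_reals.
From mathcomp Require Import measure lebesgue_measure.

Set Implicit Arguments.
Unset Strict Implicit.
Unset Printing Implicit Defensive.

Import GRing.Theory Num.Theory.

Local Open Scope classical_set_scope.
Local Open Scope card_scope.
Local Open Scope complex_scope.
Local Open Scope ring_scope.

(** The derived subgroup acts through [chi] and commutators are central, so
    [rho g] and [rho h] commute up to the scalar [chi [~ g, h]], and this pairing
    is multiplicative in [g] and in [h]. Its radical [Z] is the set of elements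
    whose operator commutes with the representation; it is the preimage of the
    center of the image group, so the quotient of the image group by its center
    is [G / Z] ([to_central_quotient_eqP]).

    By Schur's lemma every element of [Z] acts as a scalar. As [V] is not known to
    be finite dimensional, an eigenvalue has to come from Dixmier's argument
    ([dixmier], [schur]): a finitely generated group is countable, so [V] has
    countable dimension, while the resolvents of a nonscalar intertwiner would
    give uncountably many independent vectors.

    If [V] has dimension [n], determinants of commutators are one, so [chi] has
    exponent [n] ([character_pow_dim]); this gives finite order and the
    divisibility of [n] by the order. Conversely, if [chi] has exponent [m],
    pairing with the generators embeds [G / Z] into a finite power of the group
    of [m]-th roots of unity ([central_quotient_finite]), and the translates of
    a nonzero vector by representatives of [G / Z] span [V].

    For the dimension formula, let [k] be the order of [G / Z] and consider the
    operator on [n] by [n] matrices that sends [X] to the sum, over [g] in [G / Z],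
    of the conjugates of [X] by [rho g]. By Schur's lemma its value is the scalar
    matrix [(k / n) * \tr X], so its trace is [k]. On the other hand conjugation by
    [rho g] has trace [\tr (rho g) * \tr (rho g)^-1], which is [n ^ 2] for the
    trivial coset and zero for the others, because outside [Z] some conjugate of
    [rho g] is a multiple of it by a scalar other than one. So [k = n ^ 2]
    ([sqr_dim_eq_size], [dim_sqr]). *)

(** * Dixmier's argument: an operator outside the scalars has too many resolvents *)

Lemma uncountable_complex (R : realType) : ~ countable [set: R[i]].
Proof.
move=> /countable_injP[f f_inj].
have cI : countable `[(0 : R), 1].
  apply/countable_injP; exists (f \o real_complex R) => x y _ _ /= fxy.
  by apply: (@fmorph_inj _ _ (real_complex R)); apply: f_inj => //; rewrite in_setT.
have := countable_lebesgue_measure0 cI.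
by rewrite lebesgue_measure_itv /= lte01 oppr0 adde0 => /eqP; rewrite onee_eq0.
Qed.

Section PolynomialAction.
Variables (C : comNzRingType) (V : lmodType C) (T : {linear V -> V}).

(** The value of the polynomial at the operator [T], applied to [v]. It acts on
    vectors rather than living in an endomorphism algebra because [V] may be
    infinite dimensional. *)
Definition poly_act (p : {poly C}) (v : V) : V :=
  \sum_(i < size p) p`_i *: iter i T v.

Lemma poly_act_wide n (p : {poly C}) v : (size p <= n)%N ->
  poly_act p v = \sum_(i < n) p`_i *: iter i T v.
Proof.
move=> le_pn; rewrite /poly_act (big_ord_widen n (fun i => p`_i *: iter i T v)) //.
rewrite big_mkcond; apply: eq_bigr => i _.
by case: ltnP => // le_pi; rewrite nth_default // scale0r.
Qed.

Lemma iter_is_linear i : linear (iter i T).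
Proof. by elim: i => [|i IH] a u v //=; rewrite IH linearP. Qed.

Lemma poly_act_is_linear p : linear (poly_act p).
Proof.
move=> a u v; rewrite /poly_act scaler_sumr -big_split /=.
by apply: eq_bigr => i _; rewrite iter_is_linear scalerDr !scalerA mulrC.
Qed.

HB.instance Definition _ p := GRing.isLinear.Build C V V _ (poly_act p)
  (poly_act_is_linear p).

Lemma poly_act1 v : poly_act 1 v = v.
Proof. by rewrite /poly_act size_poly1 big_ord1 coef1 scale1r. Qed.

Lemma poly_actZ a p v : poly_act (a *: p) v = a *: poly_act p v.
Proof.
rewrite (poly_act_wide v (size_scale_leq a p)) scaler_sumr.
by apply: eq_bigr => i _; rewrite coefZ scalerA.
Qed.

Lemma poly_actD p q v : poly_act (p + q) v = poly_act p v + poly_act q v.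
Proof.
rewrite (poly_act_wide v (size_polyD p q)).
rewrite (@poly_act_wide _ p v (leq_maxl _ (size q))).
rewrite (@poly_act_wide _ q v (leq_maxr (size p) _)) -big_split /=.
by apply: eq_bigr => i _; rewrite coefD scalerDl.
Qed.

Lemma poly_act_sum (I : Type) (s : seq I) (p : I -> {poly C}) v :
  poly_act (\sum_(i <- s) p i) v = \sum_(i <- s) poly_act (p i) v.
Proof.
elim/big_rec2: _ => [|i q w _ <-]; last by rewrite poly_actD.
by rewrite /poly_act size_poly0 big_ord0.
Qed.

Lemma poly_act_mulXsubC p a v :
  poly_act (p * ('X - a%:P)) v = poly_act p (T v - a *: v).
Proof.
have actX : poly_act (p * 'X) v = poly_act p (T v).
  rewrite (@poly_act_wide (size p).+1); last first.
    by rewrite (leq_trans (size_polyMleq _ _)) // size_polyX addn2.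
  rewrite big_ord_recl coefMX eqxx scale0r add0r.
  by apply: eq_bigr => i _; rewrite coefMX /= -iterSr.
rewrite mulrBr poly_actD actX -mulrN -polyCN mulrC mul_polyC poly_actZ scaleNr.
by rewrite [RHS]linearB [in RHS]linearZ.
Qed.

End PolynomialAction.

Section Spanned.
Variables (C : fieldType) (V : lmodType C) (I : Type) (e : I -> V).

Definition spanned : set V :=
  [set w | exists s : seq (C * I), w = \sum_(p <- s) p.1 *: e p.2].

Lemma spanned_family i : spanned (e i).
Proof. by exists [:: (1, i)]; rewrite big_seq1 scale1r. Qed.

Lemma spanned0 : spanned 0.
Proof. by exists [::]; rewrite big_nil. Qed.

Lemma spanned_linear a u v : spanned u -> spanned v -> spanned (a *: u + v).
Proof.
move=> [s ->] [t ->]; exists ([seq (a * p.1, p.2) | p <- s] ++ t).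
rewrite big_cat big_map scaler_sumr /=; congr (_ + _).
by apply: eq_bigr => p _; rewrite scalerA.
Qed.

End Spanned.

Section Dixmier.
Variables (C : closedFieldType) (V : lmodType C) (T : {linear V -> V}).

(** If no [T - a] has a kernel, then neither does any nonzero polynomial in [T],
    because over an algebraically closed field it is a product of such factors. *)
Lemma poly_act_eq0 (p : {poly C}) v :
    (forall a w, T w = a *: w -> w = 0) -> v <> 0 -> poly_act T p v = 0 -> p = 0.
Proof.
move=> T_inj v0; have [r ->] := closed_field_poly_normal p.
rewrite poly_actZ => /eqP; rewrite scaler_eq0 => /orP[/eqP->|/eqP act0].
  by rewrite scale0r.
suff: v = 0 by [].
elim: r v {v0} act0 => [|a r IH] v; first by rewrite big_nil poly_act1.
rewrite big_cons mulrC poly_act_mulXsubC => /IH /eqP.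
by rewrite subr_eq0 => /eqP /T_inj.
Qed.

(** The vectors [u i] play the role of [(T - a i)^-1 v]. Multiplying a linear
    relation between them by the product of all the [T - a j] turns it into
    [P(T) v = 0], where [P] is the Lagrange-type combination of the products
    that omit one factor; then [P = 0], and evaluating [P] at [a i] isolates
    the coefficient [c i]. *)
Lemma resolvent_free n (a : 'I_n -> C) (c : 'I_n -> C) (u : 'I_n -> V) v :
    (forall b w, T w = b *: w -> w = 0) -> v <> 0 -> injective a ->
    (forall i, T (u i) - a i *: u i = v) -> \sum_i c i *: u i = 0 ->
  forall i, c i = 0.
Proof.
move=> T_inj v0 a_inj uP sum0.
pose q i := \prod_(j | j != i) ('X - (a j)%:P).
have q_act i : poly_act T (q i) v = poly_act T (\prod_j ('X - (a j)%:P)) (u i).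
  by rewrite (bigD1 i) //= mulrC poly_act_mulXsubC uP.
have P0 : \sum_i c i *: q i = 0.
  apply: (poly_act_eq0 T_inj v0).
  transitivity (poly_act T (\prod_j ('X - (a j)%:P)) (\sum_i c i *: u i)).
    rewrite linear_sum poly_act_sum; apply: eq_bigr => i _.
    by rewrite poly_actZ q_act linearZ.
  by rewrite sum0 linear0.
move=> i; have := congr1 (fun p => p.[a i]) P0.
rewrite horner0 horner_sum (bigD1 i) //= big1 => [|j ji]; last first.
  rewrite hornerZ /q (bigD1 i) ?[i == j]eq_sym //=.
  by rewrite hornerM hornerXsubC subrr mul0r mulr0.
rewrite addr0 hornerZ => /eqP; rewrite mulf_eq0 => /orP[/eqP//|].
rewrite horner_prod => /prodf_eq0[j ji].
by rewrite hornerXsubC subr_eq0 (inj_eq a_inj) eq_sym (negbTE ji).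
Qed.

(** Schur's lemma in countable dimension. If [T] is no scalar then all its
    resolvents exist, which gives a linearly independent family of vectors indexed
    by the uncountable field. Each of its members is supported on a finite list of
    the countable spanning family, so infinitely many share one list [t]; but more
    than [size t] vectors in the span of [size t] vectors are dependent. *)
Lemma dixmier (W : countType) (e : W -> V) :
    ~ countable [set: C] -> (forall w, spanned e w) -> (exists v : V, v <> 0) ->
    (forall a, (forall v, T v = a *: v) \/
       (forall v, T v = a *: v -> v = 0) /\
       (forall w, exists v, T v - a *: v = w)) ->
  exists a, forall v, T v = a *: v.
Proof.
move=> C_unc e_span [v v0] T_schur; apply: contrapT => T_nscal.
have T_inj a w : T w = a *: w -> w = 0.
  by have [Ta|[+ _]] := T_schur a; [case: T_nscal; exists a | exact].
have /choice[u uP] : forall a, exists w, T w - a *: w = v.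
  by move=> a; have [Ta|[_ +]] := T_schur a; [case: T_nscal; exists a | exact].
have /choice[s sP] := fun a => e_span (u a).
have [t t_inf] : exists t, infinite_set [set a | unzip2 (s a) = t].
  apply: contrapT => fin; apply: C_unc.
  have -> : [set: C] = \bigcup_t [set a | unzip2 (s a) = t].
    by apply/seteqP; split => // a _; exists (unzip2 (s a)).
  apply: bigcup_countable => // t _; apply: finite_set_countable.
  by apply: contrapT => inf; apply: fin; exists t.
have [A At lt_tA] := infinite_set_fset (size t).+1 t_inf.
pose n := size (finmap.enum_fset A).
pose a (i : 'I_n) := (finmap.enum_fset A)`_i.
have a_inj : injective a.
  move=> i j /eqP; rewrite nth_uniq ?finmap.fset_uniq // => /eqP.
  exact: val_inj.
have at_ i : unzip2 (s (a i)) = t by apply: At; apply: mem_nth.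
have size_s i : size (s (a i)) = size t by rewrite -(at_ i) size_map.
(* A default entry for [nth]; if no [W] is at hand, [t] is empty and the
   resolvent vectors vanish, which contradicts [v <> 0]. *)
have C00 : (C * W)%type.
  have : (0 < size (finmap.enum_fset A))%N by apply: leq_trans lt_tA.
  case: (t) at_ => [|w t' at_ _]; last exact: (0, w).
  move=> at_ n0; exfalso; have := uP (a (Ordinal n0)).
  rewrite sP; case: (s _) (at_ (Ordinal n0)) => //= _.
  by rewrite big_nil linear0 scaler0 subr0 => /esym.
pose M := \matrix_(i < n, j < size t) (nth C00 (s (a i)) j).1.
have uM i : u (a i) = \sum_(j < size t) M i j *: e (nth C00.2 t j).
  have tE k : (k < size t)%N -> nth C00.2 t k = (nth C00 (s (a i)) k).2.
    by move=> lt_kt; rewrite -[in LHS](at_ i) (nth_map C00) ?size_s.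
  rewrite sP (big_nth C00) big_mkord size_s.
  by apply: eq_bigr => j _; rewrite mxE tE.
have /rowV0Pn[c /sub_kermxP cM c0] : kermx M != 0.
  rewrite -mxrank_eq0 mxrank_ker subn_eq0 -ltnNge.
  exact: leq_ltn_trans (rank_leq_col M) lt_tA.
have : forall i, c 0 i = 0.
  apply: (resolvent_free (u := u \o a) T_inj v0 a_inj) => [i|]; first exact: uP.
  under eq_bigr do rewrite /= uM scaler_sumr.
  rewrite exchange_big big1 //= => j _.
  under eq_bigr do rewrite scalerA.
  rewrite -scaler_suml; have /matrixP/(_ 0 j) := cM.
  by rewrite !mxE => ->; rewrite scale0r.
by move=> c00; case/negP: c0; apply/eqP/rowP => i; rewrite mxE.
Qed.

End Dixmier.

(** * Finite spanning families and finite dimension *)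

Section FiniteSpan.
Variables (C : fieldType) (V : lmodType C).

Definition spans n (e : 'I_n -> V) :=
  forall w, exists y : 'rV[C]_n, w = \sum_i y 0 i *: e i.

Lemma spans_remove n (e : 'I_n.+1 -> V) (x : 'rV[C]_n.+1) j :
  spans e -> \sum_i x 0 i *: e i = 0 -> x 0 j != 0 ->
  spans (e \o lift j).
Proof.
move=> e_span x_rel xj w; have [y ->] := e_span w.
pose z := y - (y 0 j / x 0 j) *: x.
have zj : z 0 j = 0 by rewrite !mxE divfK ?subrr.
exists (\row_i z 0 (lift j i)).
transitivity (\sum_i z 0 i *: e i).
  under [RHS]eq_bigr do rewrite !mxE scalerDl scaleNr -scalerA.
  by rewrite big_split sumrN /= -scaler_sumr x_rel scaler0 subr0.
rewrite (bigD1_ord j) //= zj scale0r add0r.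
by apply: eq_bigr => i _; rewrite mxE.
Qed.

(** Members involved in a linear relation are discarded until none remains; the
    coordinates are then unique, hence linear. *)
Lemma spans_finite_dimensional n (e : 'I_n -> V) :
  spans e -> finite_dimensional V.
Proof.
elim: n e => [|n IH] e e_span.
  exists 0%N; apply: inhabits; exists (fun=> 0).
    by move=> a u v; rewrite scaler0 addr0.
  exists (fun=> 0) => [v|y]; last by apply/rowP => -[].
  by have [y ->] := e_span v; rewrite big_ord0.
have [[x [j [x_rel xj]]]|free] :=
    pselect (exists x : 'rV[C]_n.+1, exists j, \sum_i x 0 i *: e i = 0 /\ x 0 j != 0).
  exact: IH (spans_remove e_span x_rel xj).
pose L (y : 'rV[C]_n.+1) := \sum_i y 0 i *: e i.
have L_lin : linear L.
  move=> a y z; rewrite /L scaler_sumr -big_split; apply: eq_bigr => i _ /=.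
  by rewrite !mxE scalerDl scalerA.
have L_inj y z : L y = L z -> y = z.
  move=> Lyz; apply/rowP => i; apply: contrapT => /eqP yzi; apply: free.
  exists (y - z), i; split; last by rewrite !mxE subr_eq0.
  by have := L_lin (-1) z y; rewrite Lyz !scaleN1r addNr [- z + y]addrC.
have /choice[c cP] := e_span.
have LK : cancel c L by move=> w; rewrite /L -cP.
have cK : cancel L c by move=> y; apply: L_inj; rewrite LK.
exists n.+1; apply: inhabits; exists c; last by exists L.
by move=> a u v; apply: L_inj; rewrite L_lin !LK.
Qed.

Lemma finite_spanned (I : eqType) (t : seq I) (e : I -> V) :
  (forall i, i \in t) -> (forall w, spanned e w) -> finite_dimensional V.
Proof.
move=> tI e_span.
apply: (@spans_finite_dimensional (size t) (fun i => e (tnth (in_tuple t) i))).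
move=> w; have [s ->] := e_span w.
elim: s => [|[a i] s [y IH]].
  by exists 0; rewrite big_nil big1 // => i _; rewrite mxE scale0r.
have lt_i : (index i t < size t)%N by rewrite index_mem.
exists (a *: delta_mx 0 (Ordinal lt_i) + y); rewrite big_cons {}IH /=.
under [RHS]eq_bigr do rewrite !mxE scalerDl.
rewrite big_split /=; congr (_ + _).
rewrite (bigD1 (Ordinal lt_i)) //= !eqxx mulr1 big1 => [|j ji]; last first.
  by rewrite (negbTE ji) mulr0 scale0r.
by rewrite addr0 (tnth_nth i) /= nth_index.
Qed.

End FiniteSpan.

(** * Irreducible representations and Schur's lemma *)

Section Representation.
Variables (C : fieldType) (G : groupType) (V : lmodType C).
Variable rho : representation G V.

Lemma repr1 v : rho 1%g v = v.
Proof. by apply: (bij_inj (repr_bij rho 1%g)); rewrite -reprM mulg1. Qed.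

Hypothesis rho_irr : irreducible rho.

Lemma irreducible_neq0 : exists v : V, v <> 0.
Proof.
case: rho_irr => V0 _; apply: contrapT => none; apply: V0.
apply/seteqP; split => // v _; apply: contrapT => v0; apply: none.
by exists v.
Qed.

Lemma irreducible_full (W : set V) :
    W 0 -> (forall a u v, W u -> W v -> W (a *: u + v)) ->
    (forall g v, W v -> W (rho g v)) -> (exists2 v, W v & v <> 0) ->
  forall v, W v.
Proof.
move=> W0 WL WG [u Wu u0] v.
have sW : linear_subspace W.
  split; first exact/mem_set.
  by move=> a x y /set_mem Wx /set_mem Wy; apply/mem_set/WL.
have [W_eq|->//] := proj2 rho_irr W sW WG.
by case: u0; move: Wu; rewrite W_eq.
Qed.

(** The span of a family is invariant as soon as the images of the members of the
    family are in it; this is how orbits of a vector, and orbits under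
    representatives of a finite quotient, are seen to span [V]. *)
Lemma spanned_full (I : Type) (e : I -> V) :
    (forall g i, spanned e (rho g (e i))) -> (exists i, e i <> 0) ->
  forall v, spanned e v.
Proof.
move=> eG [i ei0]; apply: irreducible_full; first exact: spanned0.
- by move=> a u v; apply: spanned_linear.
- move=> g v [s ->]; rewrite linear_sum; elim: s => [|p s IH].
    by rewrite big_nil; apply: spanned0.
  by rewrite big_cons linearZ; apply: spanned_linear; [apply: eG | apply: IH].
by exists (e i); first exact: spanned_family.
Qed.

(** Kernel and image of an intertwiner are invariant subspaces. *)
Lemma schur_dichotomy (T : {linear V -> V}) :
    (forall g v, T (rho g v) = rho g (T v)) ->
  (forall v, T v = 0) \/ (forall v, T v = 0 -> v = 0) /\ (forall w, exists v, T v = w).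
Proof.
move=> TG; have [T0|TN0] := pselect (forall v, T v = 0); [by left | right].
have [u u0] : exists u, T u <> 0.
  apply: contrapT => none; apply: TN0 => v; apply: contrapT => v0.
  by apply: none; exists v.
split.
  move=> v Tv; apply: contrapT => v0; apply: u0; move: u.
  apply: (@irreducible_full [set x | T x = 0]) => /=; first exact: linear0.
  - by move=> a x y Tx Ty; rewrite linearP Tx Ty scaler0 addr0.
  - by move=> g x Tx; rewrite TG Tx linear0.
  by exists v.
apply: (@irreducible_full [set w | exists v, T v = w]) => /=.
- by exists 0; rewrite linear0.
- by move=> a _ _ [x <-] [y <-]; exists (a *: x + y); rewrite linearP.
- by move=> g _ [x <-]; exists (rho g x); rewrite TG.
by exists (T u) => //; exists u.
Qed.

End Representation.

Lemma generated_ind (G : groupType) (A : set G) (P : G -> Prop) :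
    P 1%g -> (forall x y, P x -> P y -> P (x / y)%g) -> (forall x, A x -> P x) ->
  forall x, generated A x -> P x.
Proof.
move=> P1 PD PA; apply: (@smallest_sub _ _ _ P) => //; split; first exact/mem_set.
by move=> x y /set_mem Px /set_mem Py; apply/mem_set/PD.
Qed.

(** [(b, i)] encodes the [i]-th generator or its inverse. Words form a countable
    type, and so index a countable spanning family of any cyclic representation
    of a finitely generated group. *)
Definition word (G : groupType) (s : seq G) (w : seq (bool * nat)) : G :=
  (\prod_(p <- w) if p.1 then nth 1 s p.2 else (nth 1 s p.2)^-1)%g.

Lemma word_surjective (G : groupType) (s : seq G) :
  generated [set` s] = [set: G] -> forall g, exists w, word s w = g.
Proof.
move=> sG g; have : generated [set` s] g by rewrite sG.
move: g; apply: generated_ind.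
- by exists [::]; rewrite /word big_nil.
- move=> _ _ [u <-] [v <-].
  exists (u ++ rev [seq (~~ p.1, p.2) | p <- v]).
  rewrite /word big_cat /=; congr (_ * _)%g.
  rewrite -[in RHS](revK v) -prodgV -map_rev big_map; apply: eq_bigr => -[[] i] _ //=.
  by rewrite invgK.
move=> x /= xs; exists [:: (true, index x s)].
by rewrite /word big_seq1 /= nth_index.
Qed.

Section Schur.
Variables (C : closedFieldType) (G : groupType) (V : lmodType C).
Variable rho : representation G V.
Hypotheses (C_unc : ~ countable [set: C]) (G_fg : finitely_generated G).
Hypothesis rho_irr : irreducible rho.

Lemma schur (T : {linear V -> V}) :
    (forall g v, T (rho g v) = rho g (T v)) ->
  exists a, forall v, T v = a *: v.
Proof.
move=> TG; have [A /finite_seqP[s ->] sG] := G_fg.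
have [v v0] := irreducible_neq0 rho_irr.
apply: (@dixmier _ _ _ _ (fun w => rho (word s w) v)) => //; last 2 first.
- by exists v.
- move=> a; pose S : {linear V -> V} := T \- a \*: idfun.
  have SE w : S w = T w - a *: w by [].
  have SG g w : S (rho g w) = rho g (S w).
    by rewrite !SE TG [RHS]linearB [in RHS]linearZ.
  have [S0|[S_inj S_surj]] := schur_dichotomy rho_irr SG.
    by left=> w; apply/eqP; rewrite -subr_eq0 -SE S0.
  by right; split=> // w Tw; apply: S_inj; rewrite SE Tw subrr.
apply: (spanned_full rho_irr) => [g w|].
  rewrite -reprM; have [w' <-] := word_surjective sG (g * word s w)%g.
  exact: spanned_family (fun w => rho (word s w) v) w'.
by exists [::]; rewrite /word big_nil repr1.
Qed.

End Schur.

(** * The commutator pairing and the central quotient of the image *)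

Section Cosets.
Variables (G : groupType) (N : normalSubgroup G).

Definition coset (x : G) : quotient_group N :=
  \pi_{eq_quot (coset_equiv N)}%qT x.

Lemma cosetM x y : coset (x * y)%g = (coset x * coset y)%g.
Proof. by rewrite /coset -quot_mulE. Qed.

Lemma coset_eqP x y : coset x = coset y <-> nsub_set N (x^-1 * y)%g.
Proof.
split=> [xy|Nxy]; first by have /(eqmodP (coset_equiv N))/asboolP := xy.
exact/(eqmodP (coset_equiv N))/asboolP.
Qed.

Lemma coset_surj a : exists x, coset x = a.
Proof. by exists (repr a); rewrite /coset reprK. Qed.

End Cosets.

Section CommutatorPairing.
Variables (C : fieldType) (G : groupType) (V : lmodType C).
Variables (rho : representation G V) (chi : G -> C).
Hypotheses (G_nil : two_step_nilpotent G) (rho_irr : irreducible rho).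
Hypothesis chiP : restricts_to rho (derived_subgroup G) chi.

Local Notation pair g h := (chi [~ g, h]%g).

Lemma derived_comm (x y : G) : derived_subgroup G [~ x, y]%g.
Proof. by apply: sub_gen_smallest; exists x => //; exists y. Qed.

Lemma derived_central (x y : G) : derived_subgroup G x -> commute x y.
Proof.
move=> Gx; apply/commgP/eqP.
suff : [set (1 : G)%g] [~ x, y]%g by [].
by rewrite -G_nil; apply: sub_gen_smallest; exists x => //; exists y.
Qed.

Lemma chiM (x y : G) : derived_subgroup G x -> derived_subgroup G y ->
  chi (x * y)%g = chi x * chi y.
Proof. exact: (proj2 (proj1 chiP)). Qed.

Lemma chi_neq0 (x : G) : derived_subgroup G x -> chi x != 0.
Proof. exact: (proj1 (proj1 chiP)). Qed.

Lemma chi1 : chi 1%g = 1.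
Proof.
have G1 : derived_subgroup G 1%g by rewrite -(commgg 1%g); apply: derived_comm.
by apply: (mulfI (chi_neq0 G1)); rewrite -chiM // !mulr1 mulg1.
Qed.

(** In nilpotency class two, commutators are central, so that the commutator, and
    hence its image under [chi], is multiplicative in each argument. *)
Lemma pairMl (x y z : G) : pair (x * y)%g z = pair x z * pair y z.
Proof.
rewrite -chiM; try exact: derived_comm; congr chi.
rewrite commgEl conjMg invgM -mulgA [(x^-1 * _)%g]mulgA -commgEl.
by rewrite [([~ x, z] * _)%g](derived_central _ (derived_comm x z)) mulgA
           -commgEl (derived_central _ (derived_comm y z)).
Qed.

Lemma pairV (x y : G) : pair y x = (pair x y)^-1.
Proof.
apply: (mulfI (chi_neq0 (derived_comm x y))).
rewrite mulfV ?chi_neq0 //; last exact: derived_comm.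
rewrite -chiM; try exact: derived_comm.
by rewrite -(invgR x y) mulgV chi1.
Qed.

Lemma pairMr (x y z : G) : pair x (y * z)%g = pair x y * pair x z.
Proof. by rewrite pairV pairMl invfM -!pairV. Qed.

Lemma pairVl (x y : G) : pair x^-1%g y = (pair x y)^-1.
Proof.
apply: (mulfI (chi_neq0 (derived_comm x y))).
by rewrite -pairMl mulgV comm1g chi1 mulfV // chi_neq0 //; apply: derived_comm.
Qed.

Lemma pairVr (x y : G) : pair x y^-1%g = (pair x y)^-1.
Proof. by rewrite pairV pairVl -pairV. Qed.

Lemma repr_comm (g h : G) v : rho [~ g, h]%g v = pair g h *: v.
Proof. by apply: (proj2 chiP); apply: derived_comm. Qed.

Lemma repr_commute (g h : G) v : rho g (rho h v) = pair g h *: rho h (rho g v).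
Proof. by rewrite -!reprM commgC reprM repr_comm linearZ. Qed.

Lemma pair_eq1P (g h : G) : pair g h = 1 <-> kernel rho [~ g, h]%g.
Proof.
split=> [gh1 v|/= ker]; first by rewrite repr_comm gh1 scale1r.
have [v /eqP v0] := irreducible_neq0 rho_irr.
have := ker v; rewrite repr_comm -{2}[v]scale1r => /eqP.
by rewrite -subr_eq0 -scalerBl scaler_eq0 (negbTE v0) orbF subr_eq0 => /eqP.
Qed.

(** The radical of the pairing consists of the elements whose operator commutes
    with the whole representation: it is the preimage in [G] of the center of
    the image group. *)
Definition radical : set G := [set g | forall h, pair g h = 1].

Definition to_central_quotient (g : G) :
    quotient_group (center_nsub (repr_image_group rho)) :=
  coset (center_nsub (repr_image_group rho)) (coset (kernel_nsub rho) g).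

Local Notation Q := (quotient_group (center_nsub (repr_image_group rho))).
Local Notation f := to_central_quotient.

Lemma to_central_quotientM g h : f (g * h)%g = (f g * f h)%g.
Proof. by rewrite /f !cosetM. Qed.

Lemma to_central_quotient_surj q : exists g, f g = q.
Proof.
have [a <-] := coset_surj q; have [g <-] := coset_surj a.
by exists g.
Qed.

Lemma image_centralP (g : G) :
  center (repr_image_group rho) (coset (kernel_nsub rho) g) <-> radical g.
Proof.
have commE h : [~ g, h]%g = ((h * g)^-1 * (g * h))%g.
  by rewrite commgEl conjgE invgM !mulgA.
split=> [Zg h|Zg a].
  apply/pair_eq1P; rewrite commE; apply/(coset_eqP (kernel_nsub rho)).
  by rewrite !cosetM; apply/esym/Zg.
have [h <-] := coset_surj a; rewrite /commute -!cosetM; apply/esym/coset_eqP.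
by rewrite -commE; apply/pair_eq1P.
Qed.

Lemma to_central_quotient_eqP g h : f g = f h <-> radical (g^-1 * h)%g.
Proof.
have piV x : coset (kernel_nsub rho) x^-1 = (coset (kernel_nsub rho) x)^-1%g.
  by apply: (mulgI (coset (kernel_nsub rho) x)); rewrite -cosetM !mulgV.
by rewrite -image_centralP cosetM piV; apply: coset_eqP.
Qed.

Lemma radical_eq1P g : f g = 1%g <-> radical g.
Proof.
have -> : 1%g = f 1%g by [].
have -> : (f g = f 1%g) <-> (f 1%g = f g) by split => /esym.
by rewrite to_central_quotient_eqP invg1 mul1g.
Qed.

End CommutatorPairing.

(** * Finite order of the central character *)

Section FiniteOrder.
Variables (C : closedFieldType) (G : groupType) (V : lmodType C).
Variables (rho : representation G V) (chi : G -> C).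
Hypotheses (C_unc : ~ countable [set: C]) (G_fg : finitely_generated G).
Hypotheses (G_nil : two_step_nilpotent G) (rho_irr : irreducible rho).
Hypothesis chiP : restricts_to rho (derived_subgroup G) chi.

Local Notation Q := (quotient_group (center_nsub (repr_image_group rho))).
Local Notation f := (to_central_quotient rho).

Lemma radical_scalar g : radical chi g -> exists a, forall v, rho g v = a *: v.
Proof.
move=> Zg; apply: (schur C_unc G_fg rho_irr) => h v.
by rewrite (repr_commute chiP) Zg scale1r.
Qed.

(** Pairing with the generators embeds the central quotient into a finite power of
    the group of [m]-th roots of unity. *)
Lemma central_quotient_finite m :
    (0 < m)%N -> character_pow_trivial (derived_subgroup G) chi m ->
  finite_set [set: Q].
Proof.
move=> m_gt0 chim; have [A /finite_seqP[s ->] sG] := G_fg.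
have [z zE] := closed_field_poly_normal ('X^m - 1 : {poly C}).
have pair_z g h : chi [~ g, h]%g \in z.
  have : root ('X^m - 1 : {poly C}) (chi [~ g, h]%g).
    by rewrite rootE !hornerE chim ?subrr //; apply: derived_comm.
  rewrite zE rootZ ?root_prod_XsubC // lead_coefDl ?lead_coefXn ?oner_eq0 //.
  by rewrite size_polyXn size_polyN size_poly1.
have /choice[r rP] := @to_central_quotient_surj _ _ _ rho.
(* The value at the [i]-th generator is recorded by its index in the list [z] of
   roots of unity, which makes the target of [phi] a finite type. *)
pose phi q : {ffun 'I_(size s) -> 'I_(size z).+1} :=
  [ffun i : 'I_(size s) => inord (index (chi [~ r q, nth 1%g s i]%g) z)].
have phi_inj : injective phi.
  move=> q q' eq_phi; rewrite -(rP q) -(rP q').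
  apply/(to_central_quotient_eqP rho_irr chiP) => h.
  have eq_pair : chi [~ r q, h]%g = chi [~ r q', h]%g.
    have : generated [set` s] h by rewrite sG.
    move: h; apply: generated_ind => [|x y Px Py|x /= xs].
    - by rewrite !commg1.
    - by rewrite !(pairMr G_nil chiP) !(pairVr G_nil chiP) Px Py.
    have lt_x : (index x s < size s)%N by rewrite index_mem.
    have := congr1 (fun F : {ffun _ -> _} => nat_of_ord (F (Ordinal lt_x))) eq_phi.
    rewrite !ffunE /= nth_index // !inordK ?ltnS ?index_size //.
    by move=> /(congr1 (nth 0 z)); rewrite !nth_index.
  rewrite (pairMl G_nil chiP) (pairVl G_nil chiP) eq_pair mulVf //.
  by apply: (chi_neq0 chiP); apply: derived_comm.
rewrite -(preimage_setT phi); apply: finite_preimage; last exact: finite_finset.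
by move=> x y _ _; apply: phi_inj.
Qed.

(** The orbit of a vector under representatives of the central quotient spans,
    because any other group element differs from a representative by a scalar. *)
Lemma central_quotient_finite_dimensional :
  finite_set [set: Q] -> finite_dimensional V.
Proof.
move=> /finite_seqP[t tE].
have tQ q : q \in t by have : [set: Q] q by []; rewrite tE.
have [v v0] := irreducible_neq0 rho_irr.
have /choice[r rP] := @to_central_quotient_surj _ _ _ rho.
apply: (@finite_spanned _ _ _ t (fun q => rho (r q) v)) => //.
apply: (spanned_full rho_irr) => [g q|]; last first.
  exists 1%g => r0; apply: v0.
  by apply: (bij_inj (repr_bij rho (r 1%g))); rewrite r0 linear0.
rewrite -reprM; set x := (g * r q)%g.
have /(to_central_quotient_eqP rho_irr chiP)/radical_scalar[a aP] := rP (f x).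
rewrite -(mulVKg (r (f x)) x) reprM aP linearZ -[X in spanned _ X]addr0.
apply: spanned_linear; last exact: spanned0.
exact: (spanned_family (fun q => rho (r q) v)).
Qed.

End FiniteOrder.

(** * Counting the central quotient by a trace *)

Lemma mxtrace_delta (C : nzRingType) n (i j : 'I_n) :
  \tr (delta_mx i j : 'M[C]_n) = (i == j)%:R.
Proof.
rewrite /mxtrace (bigD1 i) //= big1 => [|k ki]; last by rewrite mxE (negbTE ki).
by rewrite mxE eqxx addr0.
Qed.

(** Here [M] is the matrix form of a representation acting on row vectors, hence
    the reversed order in [MM]; [f] is the projection onto the quotient by the
    elements that act as scalars. *)
Section TraceCount.
Variables (C : fieldType) (n : nat) (G Q : groupType).
Variables (f : G -> Q) (M : G -> 'M[C]_n) (t : seq Q).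
Hypotheses (fM : {morph f : g h / (g * h)%g}) (f_surj : forall q, exists g, f g = q).
Hypotheses (t_uniq : uniq t) (tQ : forall q, q \in t).
Hypotheses (MM : forall g h, M (g * h)%g = M h *m M g) (M1 : M 1%g = 1%:M).
Hypothesis M_kernel : forall g, f g = 1%g -> exists a, M g = a%:M.
Hypothesis M_trace : forall g, f g <> 1%g -> \tr (M g) = 0.
Hypothesis M_schur : forall X : 'M[C]_n,
  (forall g, X *m M g = M g *m X) -> exists a, X = a%:M.

Lemma antimorph_mulV g : M g *m M g^-1%g = 1%:M.
Proof. by rewrite -MM mulVg. Qed.

Lemma antimorph_Vmul g : M g^-1%g *m M g = 1%:M.
Proof. by rewrite -MM mulgV. Qed.

Definition mxconj (X : 'M[C]_n) (g : G) : 'M[C]_n := M g *m X *m M g^-1%g.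

Lemma mxconjM X g h : mxconj X (g * h)%g = M h *m mxconj X g *m M h^-1%g.
Proof. by rewrite /mxconj MM invgM MM !mulmxA. Qed.

Lemma mxtrace_mxconj X g : \tr (mxconj X g) = \tr X.
Proof. by rewrite /mxconj mxtrace_mulC mulmxA antimorph_Vmul mul1mx. Qed.

(** Scalars cancel in the conjugation of [X], so that it makes sense to sum it over
    the quotient. *)
Lemma mxconj_coset X g h : f g = f h -> mxconj X g = mxconj X h.
Proof.
move=> fgh; have [a Ma] : exists a, M (g^-1 * h)%g = a%:M.
  apply: M_kernel; apply: (mulgI (f g)); rewrite -fM mulgA mulgV mul1g.
  by rewrite -fgh mulg1.
rewrite -[in RHS](mulVKg g h) mxconjM Ma -scalar_mxC -mulmxA -Ma.
by rewrite antimorph_mulV mulmx1.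
Qed.

(** The sum of the conjugates of [X] commutes with all the [M g], so it is a scalar
    by Schur's lemma; taking traces computes [n] times this scalar. *)
Lemma mxconj_average (r : Q -> G) X : (forall q, f (r q) = q) ->
  exists2 a, \sum_(q <- t) mxconj X (r q) = a%:M
           & a *+ n = \tr X *+ size t.
Proof.
move=> rP; set P := \sum_(q <- t) _.
have [h|a Pa] := @M_schur P; last first.
  exists a => //; rewrite -mxtrace_scalar -Pa raddf_sum /=.
  under eq_bigr do rewrite mxtrace_mxconj.
  by rewrite big_const_seq count_predT iter_addr_0.
have PJ : M h *m P *m M h^-1%g = P.
  rewrite mulmx_sumr mulmx_suml.
  under eq_bigr => q _.
    rewrite -mxconjM (mxconj_coset X (esym (rP (f (r q * h)%g)))) ?rP // fM rP.
    over.
  rewrite -(big_map (fun q => (q * f h)%g) predT (fun q => mxconj X (r q))).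
  apply: perm_big; apply: uniq_perm => //; first by rewrite map_inj_uniq //; apply: mulIg.
  move=> q; rewrite tQ; apply/mapP; exists (q / f h)%g => //.
  by rewrite mulgVK.
by rewrite -{1}PJ -mulmxA antimorph_Vmul mulmx1.
Qed.

(** Both sides are [n] times the trace of the operator on matrices that sends [X] to
    the sum of its conjugates: conjugation by [A] has trace [\tr A * \tr A^-1],
    while by [mxconj_average] the whole operator sends [X] to a scalar matrix, and
    [n] times that scalar is [\tr X *+ size t]. The trace is computed entrywise on
    the basis of elementary matrices. *)
Lemma sum_mxtrace_mulV (r : Q -> G) : (forall q, f (r q) = q) ->
  (\sum_(q <- t) \tr (M (r q)) * \tr (M (r q)^-1%g)) *+ n = (n * size t)%:R.
Proof.
move=> rP.
have /choice[a aP] (ij : 'I_n * 'I_n) : exists a,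
    \sum_(q <- t) mxconj (delta_mx ij.1 ij.2) (r q) = a%:M
    /\ a *+ n = (ij.1 == ij.2)%:R *+ size t.
  have [a] := mxconj_average (delta_mx ij.1 ij.2) rP.
  by rewrite mxtrace_delta => Ea aN; exists a.
have entry i j g : (mxconj (delta_mx i j) g) i j = M g i i * M g^-1%g j j.
  rewrite /mxconj mxE (bigD1 j) //= big1 => [|k kj].
    rewrite mxE (bigD1 i) //= big1 => [|k ki]; last by rewrite mxE (negbTE ki) mulr0.
    by rewrite mxE !eqxx mulr1 !addr0.
  rewrite mxE big1 ?mul0r // => l _.
  by rewrite mxE (negbTE kj) andbF mulr0.
have -> : \sum_(q <- t) \tr (M (r q)) * \tr (M (r q)^-1%g) =
          \sum_i \sum_j a (i, j) *+ (i == j).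
  transitivity (\sum_i \sum_j \sum_(q <- t) (mxconj (delta_mx i j) (r q)) i j).
    rewrite [RHS](eq_bigr _ (fun i _ => exchange_big _ _ _ _ _ _)) exchange_big /=.
    apply: eq_bigr => q _; rewrite mulr_suml; apply: eq_bigr => i _.
    by rewrite mulr_sumr; apply: eq_bigr => j _; rewrite entry.
  apply: eq_bigr => i _; apply: eq_bigr => j _.
  have [/(congr1 (fun A : 'M_n => A i j))] := aP (i, j).
  by rewrite summxE mxE => ->.
rewrite -sumrMnl natrM mulr_natl -[n in RHS]card_ord -sumr_const.
apply: eq_bigr => i _; rewrite -sumrMnl (bigD1 i) //= big1 => [|j ji].
  by rewrite eqxx mulr1n addr0 (proj2 (aP _)) eqxx.
by rewrite eq_sym (negbTE ji) mul0rn.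
Qed.

(** Among the terms of the previous sum only the trivial coset has a nonzero trace,
    and it contributes [n * n]. The common factor [n] replaces a division, which
    the characteristic of [C] could forbid. *)
Lemma sqr_dim_eq_size : (n * (n * n))%:R = (n * size t)%:R :> C.
Proof.
have /choice[r rP] := f_surj; rewrite -(sum_mxtrace_mulV rP).
rewrite (bigD1_seq 1%g) //= big1 => [|q q1]; last first.
  by rewrite M_trace ?mul0r // rP; apply/eqP.
have f1 : f 1%g = 1%g by apply: (mulgI (f 1%g)); rewrite -fM !mulg1.
have [a Ma] := M_kernel (rP 1%g).
have [b Mb] : exists b, M (r 1%g)^-1%g = b%:M.
  apply: M_kernel; apply: (mulgI (f (r 1%g))).
  by rewrite -fM mulgV f1 mulg1 rP.
have ab : (a * b) *+ n = n%:R.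
  by rewrite -mxtrace_scalar scalar_mxM -Ma -Mb antimorph_mulV mxtrace1.
rewrite addr0 Ma Mb !mxtrace_scalar mulrnAl mulrnAr ab.
by rewrite -!mulrnA mulnA.
Qed.

End TraceCount.

(** * Matrices of a finite-dimensional representation *)

Lemma has_dim_coordinates (C : fieldType) (V : lmodType C) n :
  has_dim V n -> exists (v2r : {linear V -> 'rV[C]_n}) (r2v : {linear 'rV[C]_n -> V}),
    cancel v2r r2v /\ cancel r2v v2r.
Proof.
move=> [[c c_lin [d cK dK]]].
have d_lin : linear d by move=> a u v; apply: (can_inj cK); rewrite c_lin !dK.
pose cL : {linear V -> 'rV[C]_n} := HB.pack c (GRing.isLinear.Build _ _ _ _ c c_lin).
pose dL : {linear 'rV[C]_n -> V} := HB.pack d (GRing.isLinear.Build _ _ _ _ d d_lin).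
by exists cL, dL.
Qed.

Section MatrixForm.
Variables (C : fieldType) (G : groupType) (V : lmodType C) (n : nat).
Variables (v2r : {linear V -> 'rV[C]_n}) (r2v : {linear 'rV[C]_n -> V}).
Hypotheses (v2rK : cancel v2r r2v) (r2vK : cancel r2v v2r).
Variables (rho : representation G V) (chi : G -> C).

Definition mxrepr g : 'M[C]_n := lin1_mx (v2r \o rho g \o r2v).

Lemma mul_mxrepr u g : u *m mxrepr g = v2r (rho g (r2v u)).
Proof. by rewrite mul_rV_lin1. Qed.

Lemma mxreprM g h : mxrepr (g * h)%g = mxrepr h *m mxrepr g.
Proof.
apply/row_matrixP => i; rewrite !rowE mulmxA !mul_mxrepr v2rK.
by rewrite reprM.
Qed.

Lemma mxrepr_scalar g a : (forall v, rho g v = a *: v) -> mxrepr g = a%:M.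
Proof.
move=> ga; apply/row_matrixP => i.
by rewrite !rowE mul_mxrepr ga linearZ r2vK mul_mx_scalar.
Qed.

Lemma mxrepr1 : mxrepr 1%g = 1%:M.
Proof. by apply: mxrepr_scalar => v; rewrite repr1 scale1r. Qed.

Lemma mxrepr_mulVl g : mxrepr g^-1%g *m mxrepr g = 1%:M.
Proof. by rewrite -mxreprM mulgV mxrepr1. Qed.

Hypothesis chiP : restricts_to rho (derived_subgroup G) chi.

(** Elements of the derived subgroup have determinant one, and they act by scalars
    of determinant [chi x ^+ n]. *)
Lemma character_pow_dim : character_pow_trivial (derived_subgroup G) chi n.
Proof.
suff detG x : derived_subgroup G x -> \det (mxrepr x) = 1.
  move=> x Gx; rewrite -det_scalar -(mxrepr_scalar (proj2 chiP x Gx)).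
  exact: detG.
apply: (@generated_ind _ _ (fun z => \det (mxrepr z) = 1)) =>
  [|{}x y dx dy|_ [{}x _ [y _ <-]]].
- by rewrite mxrepr1 det1.
- have := congr1 determinant (mxrepr_mulVl y).
  by rewrite mxreprM det1 !det_mulmx dx dy mulr1 => ->.
rewrite commgEl conjgE !mxreprM !det_mulmx.
have := congr1 determinant (mxrepr_mulVl x).
have := congr1 determinant (mxrepr_mulVl y).
rewrite !det_mulmx det1 => dy dx.
by rewrite -mulrA mulrACA ![_ * \det (mxrepr _^-1)]mulrC dy dx mulr1.
Qed.

(** Conjugating [g] by [h] multiplies its matrix by the value of the pairing at [g]
    and [h], without changing the trace. *)
Lemma mxtrace_repr_eq0 g : ~ radical chi g -> \tr (mxrepr g) = 0.
Proof.
move=> nZg; have [h /eqP gh] : exists h, chi [~ g, h]%g <> 1.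
  apply: contrapT => none; apply: nZg => h; apply: contrapT => gh.
  by apply: none; exists h.
have trJ : chi [~ g, h]%g * \tr (mxrepr g) = \tr (mxrepr g).
  rewrite -mxtraceZ -mul_scalar_mx -(mxrepr_scalar (repr_comm chiP g h)) -mxreprM.
  rewrite commgEl mulVKg conjgE !mxreprM mxtrace_mulC mulmxA.
  by rewrite mxrepr_mulVl mul1mx.
apply/eqP; move/eqP: trJ; rewrite -subr_eq0 -[X in _ - X]mul1r -mulrBl mulf_eq0.
by rewrite subr_eq0 (negbTE gh).
Qed.

End MatrixForm.

Lemma mxrepr_schur (C : closedFieldType) (G : groupType) (V : lmodType C) n
    (v2r : {linear V -> 'rV[C]_n}) (r2v : {linear 'rV[C]_n -> V})
    (rho : representation G V) (X : 'M[C]_n) :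
    ~ countable [set: C] -> finitely_generated G -> irreducible rho ->
    cancel v2r r2v -> cancel r2v v2r ->
    (forall g, X *m mxrepr v2r r2v rho g = mxrepr v2r r2v rho g *m X) ->
  exists a, X = a%:M.
Proof.
move=> C_unc G_fg rho_irr v2rK r2vK XG.
have T_lin : linear (fun v => r2v (v2r v *m X)).
  by move=> a u v; rewrite linearP mulmxDl -scalemxAl linearP.
pose T : {linear V -> V} := HB.pack (fun v => r2v (v2r v *m X))
  (GRing.isLinear.Build _ _ _ _ _ T_lin).
have [|a aP] := @schur _ _ _ rho C_unc G_fg rho_irr T.
  move=> g v; apply: (can_inj v2rK); rewrite r2vK.
  by rewrite -[v in rho g v]v2rK -!mul_mxrepr -!mulmxA XG.
exists a; apply/row_matrixP => i; rewrite !rowE mul_mx_scalar.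
by have := congr1 v2r (aP (r2v (delta_mx 0 i))); rewrite /= linearZ !r2vK.
Qed.

Lemma has_dim_gt0 (C : fieldType) (V : lmodType C) n (v : V) :
  v <> 0 -> has_dim V n -> (0 < n)%N.
Proof.
move=> v0 /has_dim_coordinates[v2r [r2v [v2rK _]]]; rewrite lt0n.
apply/eqP => n0; apply: v0; rewrite -[v]v2rK.
have -> : v2r v = 0 by apply/rowP => -[i lt_i]; exfalso; move: lt_i; rewrite n0.
exact: linear0.
Qed.

Lemma character_order_dvdn (C : fieldType) (G : groupType) (S : set G)
    (chi : G -> C) m k :
  character_order S chi m -> character_pow_trivial S chi k -> (m %| k)%N.
Proof.
move=> [m_gt0 chim m_min] chik; rewrite /dvdn -leqn0 leqNgt.
apply/negP => mod_gt0.
have := ltn_pmod k m_gt0; rewrite ltnNge m_min // => x Sx.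
have := chik x Sx; rewrite {1}(divn_eq k m) exprD mulnC exprM chim //.
by rewrite expr1n mul1r.
Qed.

Lemma character_order_exists (C : fieldType) (G : groupType) (S : set G)
    (chi : G -> C) k :
  (0 < k)%N -> character_pow_trivial S chi k -> character_finite_order S chi.
Proof.
move=> k_gt0 chik.
have ex : exists m, (0 < m)%N && `[< character_pow_trivial S chi m >].
  by exists k; rewrite k_gt0; apply/asboolP.
have [m /andP[m_gt0 /asboolP chim] m_min] := ex_minnP ex.
exists m; split=> // l l_gt0 chil; apply: m_min.
by rewrite l_gt0; apply/asboolP.
Qed.

Lemma dim_sqr (C : closedFieldType) (G : groupType) (V : lmodType C)
    (rho : representation G V) (chi : G -> C) k n :
    ~ countable [set: C] -> finitely_generated G -> irreducible rho ->
    restricts_to rho (derived_subgroup G) chi ->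
    [set: quotient_group (center_nsub (repr_image_group rho))] #= `I_k ->
    has_dim V n ->
  (n * (n * n))%:R = (n * k)%:R :> C.
Proof.
move=> C_unc G_fg rho_irr chiP Qk.
have Q_fin : finite_set [set: quotient_group (center_nsub (repr_image_group rho))].
  by apply/finite_setP; exists k.
rewrite -(card_fset_set Qk).
move=> /has_dim_coordinates[v2r [r2v [v2rK r2vK]]].
apply: (sqr_dim_eq_size (f := to_central_quotient rho) (M := mxrepr v2r r2v rho)) => //.
- exact: to_central_quotientM.
- exact: to_central_quotient_surj.
- exact: finmap.fset_uniq.
- by move=> q; rewrite in_fset_set ?in_setT.
- exact: mxreprM.
- exact: mxrepr1.
- move=> g /(radical_eq1P rho_irr chiP) Zg.
  have [a aP] := radical_scalar C_unc G_fg rho_irr chiP Zg.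
  by exists a; apply: mxrepr_scalar.
- move=> g gN1; apply: (mxtrace_repr_eq0 v2rK r2vK chiP).
  by move=> /(radical_eq1P rho_irr chiP).
by move=> X; apply: mxrepr_schur.
Qed.

(** * The theorem *)

Theorem theorem1p3 (R : realType) (G : groupType) (V : lmodType R[i])
    (rho : representation G V) (chi : G -> R[i])
    (G_fg : finitely_generated G) (G_nil : two_step_nilpotent G)
    (rho_irr : irreducible rho)
    (chiP : restricts_to rho (derived_subgroup G) chi) :
  (finite_dimensional V <-> character_finite_order (derived_subgroup G) chi) /\
  (finite_dimensional V ->
    (forall m n : nat, character_order (derived_subgroup G) chi m ->
       has_dim V n -> (m %| n)%N) /\
    (exists k : nat,
       [set: quotient_group (center_nsub (repr_image_group rho))] #= `I_k /\
       forall n : nat, has_dim V n -> n%:R = Num.sqrt (k%:R : R))).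
Proof.
have C_unc := @uncountable_complex R.
have [v v0] := irreducible_neq0 rho_irr.
have chi_dim n : has_dim V n -> character_pow_trivial (derived_subgroup G) chi n.
  by move=> /has_dim_coordinates[v2r [r2v [v2rK r2vK]]]; apply: character_pow_dim chiP.
have fin_order : finite_dimensional V -> character_finite_order (derived_subgroup G) chi.
  move=> [n dimV].
  exact: character_order_exists (has_dim_gt0 v0 dimV) (chi_dim n dimV).
have fin_quot m : character_order (derived_subgroup G) chi m -> _ :=
  fun om => let: And3 m_gt0 chim _ := om in
  central_quotient_finite G_fg G_nil rho_irr chiP m_gt0 chim.
split.
  split=> [//|[m /fin_quot]].
  exact: central_quotient_finite_dimensional C_unc G_fg rho_irr chiP.
move=> /fin_order[m om]; split=> [m' n om' dimV|].
  exact: character_order_dvdn om' (chi_dim n dimV).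
have /finite_setP[k Qk] := fin_quot m om; exists k; split=> // n dimV.
have := dim_sqr C_unc G_fg rho_irr chiP Qk dimV.
have n_gt0 := has_dim_gt0 v0 dimV.
move=> /eqP; rewrite eqr_nat eqn_pmul2l // => /eqP <-.
by rewrite mulnn natrX sqrtr_sqr ger0_norm.
Qed.
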